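(* Let $X$ be a compact metrizable space with a compatible metric $d$ and let $T:X\to X$ be a homeomorphism. Then: (1) for every $T$-ergodic Borel probability measure $\mu$ on $X$ and every $p\in[1,\infty)$, $$h_{\mu,L^p}(T)=h_{\mu,L^\infty}(T)=h_{\mu,B}(T)=h_\mu(T);$$ (2) if $(X,d,T)$ has the $g$-almost product property (for some mistake function $g$), then for every $T$-invariant Borel probability measure $\mu$ on $X$ and every $p\in[1,\infty)$, $$h_{\mu,L^p}(T)=h_{\mu,L^\infty}(T)=h_{\mu,B}(T)=h_\mu(T).$$ Here $h_{\mu,L^p}(T)$, $h_{\mu,L^\infty}(T)$, $h_{\mu,B}(T)$ are the $L^p$, $L^\infty$ and Bowen rate-distortion entropies of $\mu$, and $h_\mu(T)$ is the Kolmogorov–Sinai entropy of $\mu$.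
   Context: Logarithms are natural. Mutual information. For measurable maps $\xi:\Omega\to\mathcal M$, $\eta:\Omega\to\mathcal N$ from a probability space $(\Omega,\mathbb P)$ to measurable spaces, $I(\xi;\eta)$ is the supremum, over all finite measurable partitions $\{P_1,\dots,P_M\}$ of $\mathcal M$ and $\{Q_1,\dots,Q_N\}$ of $\mathcal N$, of $$\sum_{m,n}\mathbb P(\xi\in P_m,\eta\in Q_n)\log\frac{\mathbb P(\xi\in P_m,\eta\in Q_n)}{\mathbb P(\xi\in P_m)\mathbb P(\eta\in Q_n)},$$ with the convention $0\log\frac0a=0$ for all $a\ge0$. Rate-distortion functions. Let $\mu$ be a $T$-invariant Borel probability measure and $\epsilon>0$. In each case below the function is defined as the infimum of $\frac{I(\xi;\eta)}{n}$, where $n$ ranges over all positive integers and $\xi$ and $\eta=(\eta_0,\dots,\eta_{n-1})$ are random variables on some probability space $(\Omega,\mathbb P)$ such that $\xi$ takes values in $X$ with law $\mu$, each $\eta_k$ takes values in $X$, and the following distortion condition holds: - $R_{\mu,L^p}(\epsilon)$, $1\le p<\infty$: $\mathbb E\big(\frac1n\sum_{k=0}^{n-1}d(T^k\xi,\eta_k)^p\big)<\epsilon^p$; - $R_{\mu,L^\infty}(\epsilon,s)$, $s>0$: $\mathbb E\big(\#\{0\le k\le n-1: d(T^k\xi,\eta_k)\ge\epsilon\}\big)<sn$; - $R_{\mu,B}(\epsilon)$: $\mathbb E\big(\max_{0\le k<n}d(T^k\xi,\eta_k)\big)<\epsilon$. Put $R_{\mu,L^\infty}(\epsilon)=\lim_{s\to0}R_{\mu,L^\infty}(\epsilon,s)$.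 Rate-distortion entropies. $h_{\mu,L^p}(T)=\lim_{\epsilon\to0}R_{\mu,L^p}(\epsilon)$, $h_{\mu,L^\infty}(T)=\lim_{\epsilon\to0}R_{\mu,L^\infty}(\epsilon)$, $h_{\mu,B}(T)=\lim_{\epsilon\to0}R_{\mu,B}(\epsilon)$. $g$-almost product property. A mistake function is a non-decreasing map $g:\mathbb N\to\mathbb N$ with $g(n)<n$ for every $n\ge2$ and $\lim_{n\to\infty}g(n)/n=0$. For $x\in X$, $\epsilon>0$, the $g$-mistake Bowen ball $B_n(g;x,\epsilon)$ is the set of $y\in X$ for which there is $\Lambda\subset\{0,1,\dots,n-1\}$ with $n-\#\Lambda<g(n)$ and $\max_{j\in\Lambda}d(T^jx,T^jy)<\epsilon$. The system $(X,d,T)$ has the $g$-almost product property if there is a non-increasing function $m:\mathbb R^+\to\mathbb N$ such that for any $k\in\mathbb N$, any $x_1,\dots,x_k\in X$, any positive numbers $\epsilon_1,\dots,\epsilon_k$ and any integers $n_1\ge m(\epsilon_1),\dots,n_k\ge m(\epsilon_k)$, $$\bigcap_{j=1}^kT^{-M_{j-1}}B_{n_j}(g;x_j,\epsilon_j)\neq\emptyset,$$ where $M_0=0$ and $M_i=n_1+\cdots+n_i$ for $i=1,\dots,k-1$. *)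

(* Defs.v *)
From HB Require Import structures.
From mathcomp Require Import all_boot all_order all_algebra.
From mathcomp Require Import all_classical all_reals all_analysis.

Set Implicit Arguments.
Unset Strict Implicit.
Unset Printing Implicit Defensive.
Import Order.TTheory GRing.Theory Num.Theory.
Import numFieldNormedType.Exports.

Local Open Scope classical_set_scope.
Local Open Scope ring_scope.

(* [measurableType] extends [pointedType].  Having a point is no loss of
   generality: an empty space carries no probability measure. *)
#[short(type="pmetricType")]
HB.structure Definition PointedMetric (K : numDomainType) :=
  {M of Metric K M & Pointed M}.

Definition borel (X : ptopologicalType) := g_sigma_algebraType (@open X).

Definition homeomorphism (X Y : topologicalType) (f : X -> Y) : Prop :=
  continuous f /\ exists2 g : Y -> X, continuous g & cancel f g /\ cancel g f.

Definition finite_partition d (M : measurableType d) (m : nat)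
    (A : 'I_m -> set M) : Prop :=
  [/\ forall i, measurable (A i), trivIset [set: 'I_m] A
    & \bigcup_i A i = [set: M]].

Section MutualInformation.
Context d d1 d2 (Omega : measurableType d) (M : measurableType d1)
  (N : measurableType d2) (R : realType) (P : probability Omega R).

(* The convention [0 * log (0 / a) = 0] holds by [mul0r]. *)
Definition partition_information (xi : Omega -> M) (eta : Omega -> N)
    m n (A : 'I_m -> set M) (B : 'I_n -> set N) : R :=
  \sum_(i < m) \sum_(j < n)
    let pij := fine (P (xi @^-1` A i `&` eta @^-1` B j)) in
    let qi := fine (P (xi @^-1` A i)) in
    let rj := fine (P (eta @^-1` B j)) in
    pij * ln (pij / (qi * rj)).

Definition mutual_information (xi : {RV P >-> M}) (eta : {RV P >-> N}) :
    \bar R :=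
  ereal_sup [set I | exists m n (A : 'I_m -> set M) (B : 'I_n -> set N),
    [/\ finite_partition A, finite_partition B
      & I = (partition_information xi eta A B)%:E]].

End MutualInformation.

Section Entropy.
Context d (X : measurableType d) (R : realType) (mu : probability X R)
  (T : X -> X).

Definition invariant_measure : Prop :=
  forall A, measurable A -> mu (T @^-1` A) = mu A.

Definition ergodic_measure : Prop :=
  invariant_measure /\
  forall A, measurable A -> T @^-1` A = A -> mu A = 0%E \/ mu A = 1%E.

Definition partition_entropy (I : finType) (A : I -> set X) : R :=
  - \sum_(i : I) fine (mu (A i)) * ln (fine (mu (A i))).

(* The cells of the join of [T^-i A] for [i < n]. *)
Definition join_cell m (A : 'I_m -> set X) n (f : {ffun 'I_n -> 'I_m}) :
    set X :=
  \bigcap_(i : 'I_n) iter i T @^-1` A (f i).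

Definition partition_ks_entropy m (A : 'I_m -> set X) : R :=
  limn (fun n => partition_entropy (@join_cell m A n) / n%:R).

Definition ks_entropy : \bar R :=
  ereal_sup [set h | exists m (A : 'I_m -> set X),
    finite_partition A /\ h = (partition_ks_entropy A)%:E].

End Entropy.

Section RateDistortion.
Context (R : realType) (X : pmetricType R) (mu : probability (borel X) R)
  (T : X -> X).

Definition distortion_condition : Type :=
  forall d (Omega : measurableType d) (P : probability Omega R) (n : nat),
    (Omega -> X) -> (Omega -> n.-tuple X) -> Prop.

(* [n.-tuple (borel X)] carries the product sigma-algebra, which is the Borel
   one of X^n because compact metric spaces are second countable. *)
Definition rate_distortion (D : distortion_condition) : \bar R :=
  ereal_inf [set r | exists n d (Omega : measurableType d)
      (P : probability Omega R) (xi : {RV P >-> borel X})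
      (eta : {RV P >-> n.-tuple (borel X)}),
    [/\ (0 < n)%N,
        forall A, measurable A -> distribution P xi A = mu A,
        D d Omega P n xi eta
      & r = (mutual_information xi eta * (n%:R^-1)%:E)%E]].

Definition distortion_Lp (p eps : R) : distortion_condition :=
  fun d Omega P n xi eta =>
    ('E_P[fun w => (n%:R^-1 *
            \sum_(k < n) mdist (iter k T (xi w)) (tnth (eta w) k) `^ p)%R]
      < (eps `^ p)%:E)%E.

Definition distortion_Linfty (eps s : R) : distortion_condition :=
  fun d Omega P n xi eta =>
    ('E_P[fun w =>
            (#|[pred k : 'I_n |
                eps <= mdist (iter k T (xi w)) (tnth (eta w) k)]|%:R)%R]
      < (s * n%:R)%:E)%E.

Definition distortion_Bowen (eps : R) : distortion_condition :=
  fun d Omega P n xi eta =>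
    ('E_P[fun w => (\big[Num.max/0]_(k < n)
            mdist (iter k T (xi w)) (tnth (eta w) k))%R] < eps%:E)%E.

Definition R_Lp (p eps : R) : \bar R := rate_distortion (distortion_Lp p eps).

Definition R_Linfty_s (eps s : R) : \bar R :=
  rate_distortion (distortion_Linfty eps s).

Definition R_Linfty (eps : R) : \bar R :=
  lim (R_Linfty_s eps s @[s --> 0^'+]).

Definition R_Bowen (eps : R) : \bar R := rate_distortion (distortion_Bowen eps).

Definition h_Lp (p : R) : \bar R := lim (R_Lp p eps @[eps --> 0^'+]).

Definition h_Linfty : \bar R := lim (R_Linfty eps @[eps --> 0^'+]).

Definition h_Bowen : \bar R := lim (R_Bowen eps @[eps --> 0^'+]).

End RateDistortion.

Definition mistake_function (R : realType) (g : nat -> nat) : Prop :=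
  [/\ {homo g : m n / (m <= n)%N},
      forall n, (2 <= n)%N -> (g n < n)%N
    & (g n)%:R / n%:R @[n --> \oo] --> (0 : R)].

Section AlmostProduct.
Context (R : realType) (X : metricType R) (T : X -> X) (g : nat -> nat).

(* The maximum over an empty [L] is read as 0. *)
Definition mistake_bowen_ball (n : nat) (x : X) (eps : R) : set X :=
  [set y | exists L : {set 'I_n}, (n - #|L| < g n)%N /\
    \big[Num.max/0]_(j in L) mdist (iter j T x) (iter j T y) < eps].

(* Only the values of [m] at positive reals are used. *)
Definition almost_product_property : Prop :=
  exists m : R -> nat,
    (forall e1 e2, 0 < e1 -> e1 <= e2 -> (m e2 <= m e1)%N) /\
    forall (k : nat) (x : 'I_k -> X) (eps : 'I_k -> R) (n : 'I_k -> nat),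
      (forall j, 0 < eps j) -> (forall j, (m (eps j) <= n j)%N) ->
      \bigcap_(j : 'I_k)
        iter (\sum_(i < k | (i < j)%N) n i) T @^-1`
          mistake_bowen_ball (n j) (x j) (eps j) !=set0.

End AlmostProduct.

(* Main.v *)
Require Import Defs.
From HB Require Import structures.
From mathcomp Require Import all_boot all_order all_algebra finmap.
From mathcomp Require Import all_classical all_reals all_analysis.
From mathcomp Require Import measurable_realfun.
From mathcomp Require Import ring lra.
Set Implicit Arguments.
Unset Strict Implicit.
Unset Printing Implicit Defensive.
Import Order.TTheory GRing.Theory Num.Theory.
Import numFieldNormedType.Exports.
Local Open Scope classical_set_scope.
Local Open Scope ring_scope.

(* Each rate-distortion entropy is compared directly with the entropy of
   partitions, by two bounds holding for every invariant measure.

   Upper bound: quantizing each T^k xi by a finite partition a of small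
   diameter has information at most H(a^n), the entropy of the n-step
   itinerary, so every rate is at most H(a^n)/n for all n.

   Lower bound (Fano): given a finite partition a, regularity of mu provides a
   set K of almost full measure on which the cell of x is determined by any
   point close to x.  Hence eta predicts a(T^k xi) except when T^k xi is
   outside K or d(T^k xi, eta_k) is not small; all three distortion conditions
   make the expected fraction s of such k small.  Then
   H(a^n) <= I(xi;eta) + n (- ln (1 - t) + s ln (#a / t)) for all t in (0,1),
   while H(a^n)/n is at least its limit by Fekete's lemma. *)

(** * Entropy, information and Fano's inequality for finite tables of weights *)

Section FiniteEntropy.
Context (R : realType).

(** Summation of [ln x <= x - 1] at [x = q i / p i]. The total mass of [q] may be smaller than that
    of [p], which [fano] exploits. *)
Lemma gibbs (I : finType) (p q : I -> R) :
  (forall i, 0 <= p i) -> (forall i, 0 <= q i) ->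
  (forall i, 0 < p i -> 0 < q i) -> \sum_i q i <= \sum_i p i ->
  \sum_i p i * ln (q i) <= \sum_i p i * ln (p i).
Proof.
move=> p0 q0 pq qp; rewrite -subr_le0 -sumrB.
apply: (@le_trans _ _ (\sum_i (q i - p i))); last by rewrite sumrB subr_le0.
apply: ler_sum => i _.
have := p0 i; rewrite le_eqVlt => /predU1P[<-|pi].
  by rewrite !mul0r subrr subr0.
have qi := pq _ pi.
rewrite -mulrBr -ln_div ?posrE//.
have -> : q i / p i = 1 + (q i / p i - 1) by rewrite addrC subrK.
apply: (@le_trans _ _ (p i * (q i / p i - 1))).
  rewrite ler_pM2l//; apply: le_ln1Dx.
  by rewrite ltrBrDl subrr divr_gt0.
by rewrite mulrBr mulr1 mulrCA divff ?mulr1// gt_eqF.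
Qed.

Lemma ln_prod (I : Type) (r : seq I) (f : I -> R) :
  (forall i, 0 < f i) -> ln (\prod_(i <- r) f i) = \sum_(i <- r) ln (f i).
Proof.
move=> f0; elim: r => [|i r IH]; first by rewrite !big_nil ln1.
by rewrite !big_cons lnM ?IH// posrE ?prodr_gt0.
Qed.

Definition entropy (I : finType) (p : I -> R) : R :=
  - \sum_i p i * ln (p i).

Lemma entropy_ge0 (I : finType) (p : I -> R) :
  (forall i, 0 <= p i <= 1) -> 0 <= entropy p.
Proof.
move=> p01; rewrite oppr_ge0; apply: sumr_le0 => i _.
by have /andP[? ?] := p01 i; rewrite mulr_ge0_le0// ln_le0.
Qed.

Lemma le_sum_preim (I J : finType) (p : I -> R) (g : I -> J) j i :
  (forall i, 0 <= p i) -> g i = j -> p i <= \sum_(i | g i == j) p i.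
Proof.
move=> p0 <-; rewrite (bigD1 i)//= lerDl; exact: sumr_ge0.
Qed.

(** Merging atoms enlarges the argument of each logarithm, so a function of a variable has no more
    entropy than the variable. *)
Lemma entropy_image (I J : finType) (p : I -> R) (g : I -> J) :
  (forall i, 0 <= p i) ->
  entropy (fun j => \sum_(i | g i == j) p i) <= entropy p.
Proof.
move=> p0; rewrite lerN2 [leRHS](eq_bigr (fun j =>
    \sum_(i | g i == j) p i * ln (\sum_(i | g i == j) p i))); last first.
  by move=> j _; rewrite mulr_suml.
rewrite [leLHS](partition_big g predT)//=.
apply: ler_sum => j _; apply: ler_sum => i /eqP gij.
have := p0 i; rewrite le_eqVlt => /predU1P[<-|pi]; first by rewrite !mul0r.
rewrite ler_pM2l// ler_ln ?posrE//; first exact: le_sum_preim.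
by apply: (lt_le_trans pi); exact: le_sum_preim.
Qed.

Section joint.
Context (I J : finType) (p : I -> J -> R).
Hypothesis p0 : forall i j, 0 <= p i j.
Let p1 i := \sum_j p i j.
Let p2 j := \sum_i p i j.

Let p_le1 i j : p i j <= p1 i.
Proof. by rewrite /p1 (bigD1 j)//= lerDl sumr_ge0. Qed.

Let p_le2 i j : p i j <= p2 j.
Proof. by rewrite /p2 (bigD1 i)//= lerDl sumr_ge0. Qed.

Let p10 i : 0 <= p1 i. Proof. exact: sumr_ge0. Qed.
Let p20 j : 0 <= p2 j. Proof. exact: sumr_ge0. Qed.

(** Subadditivity, as Gibbs' inequality against the product of the two marginals. *)
Lemma entropy_joint : \sum_i p1 i = 1 ->
  entropy (fun ij : I * J => p ij.1 ij.2) <= entropy p1 + entropy p2.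
Proof.
move=> ps.
have p2s : \sum_j p2 j = 1 by rewrite exchange_big.
rewrite -opprD lerN2.
have -> : \sum_i p1 i * ln (p1 i) + \sum_j p2 j * ln (p2 j) =
    \sum_(ij : I * J) p ij.1 ij.2 * ln (p1 ij.1 * p2 ij.2).
  rewrite -(pair_bigA _ (fun i j => p i j * ln (p1 i * p2 j)))/=.
  transitivity (\sum_i \sum_j (p i j * ln (p1 i) + p i j * ln (p2 j))).
    under [RHS]eq_bigr do rewrite big_split/=.
    rewrite big_split/=; congr (_ + _).
      by apply: eq_bigr => i _; rewrite mulr_suml.
    by rewrite exchange_big/=; apply: eq_bigr => j _; rewrite mulr_suml.
  apply: eq_bigr => i _; apply: eq_bigr => j _.
  have := p0 i j; rewrite le_eqVlt => /predU1P[<-|pij].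
    by rewrite !mul0r addr0.
  by rewrite -mulrDr lnM// posrE (lt_le_trans pij).
apply: gibbs => //=.
- by move=> ij; rewrite mulr_ge0.
- by move=> ij pij; rewrite mulr_gt0// (lt_le_trans pij).
- rewrite -(pair_bigA _ (fun i j => p1 i * p2 j))/=.
  rewrite -(pair_bigA _ (fun i j => p i j))/=.
  under eq_bigr do rewrite -mulr_sumr p2s mulr1.
  by rewrite lexx.
Qed.

Definition joint_information : R :=
  \sum_i \sum_j p i j * ln (p i j / (p1 i * p2 j)).

(** Each ratio [p i j / (p1 i * p2 j)] is at most [1 / p2 j], since [p i j <= p1 i]. *)
Lemma joint_information_le_entropy :
  joint_information <= entropy p2.
Proof.
rewrite /joint_information exchange_big /entropy -sumrN; apply: ler_sum => j _.
rewrite -mulrN {2}/p2 mulr_suml; apply: ler_sum => i _.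
have := p0 i j; rewrite le_eqVlt => /predU1P[<-|pij]; first by rewrite !mul0r.
have p1i := lt_le_trans pij (p_le1 i j).
have p2j := lt_le_trans pij (p_le2 i j).
rewrite ler_pM2l// -lnV ?posrE// ler_ln ?posrE ?invr_gt0//.
  by rewrite invfM mulrA ler_piMl ?invr_ge0// ler_pdivrMr// mul1r.
by rewrite divr_gt0// mulr_gt0.
Qed.

(** The joint entropy is left as a double sum, the form in which [fano] bounds it by [gibbs]. *)
Lemma joint_informationE :
  joint_information =
  \sum_i \sum_j p i j * ln (p i j) + entropy p1 + entropy p2.
Proof.
transitivity (\sum_i \sum_j (p i j * ln (p i j) - p i j * ln (p1 i)
    - p i j * ln (p2 j))).
  apply: eq_bigr => i _; apply: eq_bigr => j _.
  have := p0 i j; rewrite le_eqVlt => /predU1P[<-|pij].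
    by rewrite !mul0r !subr0.
  have p1i := lt_le_trans pij (p_le1 i j).
  have p2j := lt_le_trans pij (p_le2 i j).
  by rewrite ln_div ?posrE// ?mulr_gt0// lnM ?posrE//; ring.
under eq_bigr do rewrite !sumrB.
rewrite !sumrB; congr (_ - _ - _).
  by apply: eq_bigr => i _; rewrite mulr_suml.
by rewrite exchange_big/=; apply: eq_bigr => j _; rewrite mulr_suml.
Qed.

End joint.

(* Gibbs' inequality against the kernel which, independently in each
   coordinate, keeps the symbol with probability [1 - t] and otherwise draws
   one uniformly. *)
Lemma fano (I : finType) n (t : R)
    (p : {ffun 'I_n -> I} -> {ffun 'I_n -> option I} -> R) :
  0 < t < 1 -> (0 < #|I|)%N ->
  (forall a b, 0 <= p a b) -> \sum_a \sum_b p a b = 1 ->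
  entropy (fun a => \sum_b p a b) <= joint_information p +
    (n%:R * - ln (1 - t) + (\sum_k \sum_a \sum_b p a b *+ (b k != Some (a k)))
                           * ln (#|I|%:R / t)).
Proof.
move=> /andP[t0 t1] I0 p0 ps.
rewrite joint_informationE//.
set p2 := fun b => \sum_a p a b.
(* The share [t / #|I|] that a uniform draw would return to the kept symbol is dropped, so the
   weights [q0 _ o] sum to at most 1. The prediction [None] is always an error. *)
pose q0 (i : I) (o : option I) : R := if o == Some i then 1 - t else t / #|I|%:R.
have q00 i o : 0 < q0 i o.
  by rewrite /q0; case: ifP => _; rewrite ?subr_gt0// divr_gt0// ltr0n.
have q0s o : \sum_i q0 i o <= 1.
  rewrite /q0; case: o => [j|] /=; last first.
    rewrite sumr_const -[_ *+ _]mulr_natr mulfVK ?(ltW t1)//.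
    by rewrite pnatr_eq0 -lt0n.
  rewrite (bigD1 j)//= eqxx -[leRHS](subrK t) lerD2l.
  apply: (@le_trans _ _ (\sum_(i : I) t / #|I|%:R)).
    rewrite [leRHS](bigD1 j)//= -[leLHS]add0r lerD ?divr_ge0 ?(ltW t0)//.
    apply: ler_sum => i ij; case: eqP => // -[ji].
    by rewrite ji eqxx in ij.
  rewrite sumr_const -[_ *+ _]mulr_natr mulfVK ?lexx//.
  by rewrite pnatr_eq0 -lt0n.
pose q (a : {ffun 'I_n -> I}) (b : {ffun 'I_n -> option I}) : R :=
  p2 b * \prod_k q0 (a k) (b k).
have p20 b : 0 <= p2 b by exact: sumr_ge0.
have prod0 (a : {ffun 'I_n -> I}) (b : {ffun 'I_n -> option I}) :
  0 < \prod_k q0 (a k) (b k) by apply: prodr_gt0.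
have ple a b : p a b <= p2 b by rewrite /p2 (bigD1 a)//= lerDl sumr_ge0.
have : \sum_ab p ab.1 ab.2 * ln (q ab.1 ab.2) <=
       \sum_ab p ab.1 ab.2 * ln (p ab.1 ab.2).
  apply: gibbs => //=.
  - by move=> [a b]; rewrite /q mulr_ge0// ltW.
  - by move=> [a b] /= pab; rewrite mulr_gt0// (lt_le_trans pab).
  - rewrite -(pair_bigA _ q)/= -(pair_bigA _ p)/=.
    (* For a fixed prediction [b], the sum over all words [a] factors into a product over the
       coordinates of sums bounded by [q0s]. *)
    rewrite exchange_big [leRHS]exchange_big/=; apply: ler_sum => b _.
    rewrite -mulr_sumr -/(p2 b) ler_piMr//.
    rewrite -(bigA_distr_bigA (fun k i => q0 i (b k)))/=.
    by apply: Num.Theory.prodr_ile1 => k _; rewrite q0s sumr_ge0// => i _; exact: ltW.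
rewrite -(pair_bigA _ (fun a b => p a b * ln (q a b)))/=.
rewrite -(pair_bigA _ (fun a b => p a b * ln (p a b)))/=.
have -> : \sum_a \sum_b p a b * ln (q a b) =
  - entropy p2 + \sum_a \sum_b \sum_k p a b * ln (q0 (a k) (b k)).
  transitivity (\sum_a \sum_b (p a b * ln (p2 b) +
      \sum_k p a b * ln (q0 (a k) (b k)))).
    apply: eq_bigr => a _; apply: eq_bigr => b _.
    have := p0 a b; rewrite le_eqVlt => /predU1P[<-|pab].
      by rewrite !mul0r big1 ?addr0// => k _; rewrite mul0r.
    rewrite /q lnM ?posrE//; last exact: lt_le_trans pab (ple _ _).
    rewrite mulrDr; congr (_ + _).
    by rewrite -mulr_sumr ln_prod.
  under eq_bigr do rewrite big_split/=.
  rewrite big_split/=; congr (_ + _).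
  rewrite opprK exchange_big/=; apply: eq_bigr => b _.
  by rewrite mulr_suml.
(* The rest is checked termwise: a correct coordinate contributes [ln (1 - t)], a wrong one
   [ln (t / #|I|)], to which the nonpositive [ln (1 - t)] may be added. *)
suff : \sum_a \sum_b \sum_k p a b * ln (q0 (a k) (b k)) >=
  - (n%:R * - ln (1 - t) + (\sum_k \sum_a \sum_b p a b *+ (b k != Some (a k)))
                           * ln (#|I|%:R / t)).
  set S := \sum_a \sum_b \sum_k _; set D := _ + _ * ln (_ / t).
  by move=> h1 h2; rewrite -subr_ge0; move: h1 h2; lra.
have lnt : ln (#|I|%:R / t) = - ln (t / #|I|%:R).
  by rewrite -lnV ?posrE ?divr_gt0 ?ltr0n// invf_div.
have nE : n%:R = \sum_(k < n) (1 : R) by rewrite sumr_const card_ord.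
rewrite lnt !mulrN -opprD opprK nE !mulr_suml -big_split/=.
under [leRHS]eq_bigr do rewrite exchange_big/=.
rewrite [leRHS]exchange_big/=; apply: ler_sum => k _.
rewrite -[X in X * ln (1 - t)]ps !mulr_suml -big_split/=.
apply: ler_sum => a _; rewrite !mulr_suml -big_split/=; apply: ler_sum => b _.
rewrite /q0; case: eqP => /= _; rewrite ?mulr0n ?mul0r ?addr0// mulr1n.
rewrite -mulrDr ler_wpM2l// gerDr ln_le0//.
by rewrite gerBl ltW.
Qed.

End FiniteEntropy.

(** * Finite-valued measurable maps and their laws *)

Section FiniteValued.

Definition fin_measurable d (T : measurableType d) (J : finType) (f : T -> J) :=
  forall j, measurable (f @^-1` [set j]).

Lemma fin_measurable_preim d (T : measurableType d) (J : finType) (f : T -> J)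
    (A : set J) : fin_measurable f -> measurable (f @^-1` A).
Proof.
move=> mf; rewrite [X in measurable X](_ : _ =
    \bigcup_(j in A) f @^-1` [set j]); last first.
  apply/seteqP; split=> [x Ax|x [j Aj /= fxj]]; first by exists (f x).
  by rewrite /preimage/= fxj.
by apply: fin_bigcup_measurable.
Qed.

Lemma fin_measurable_comp d (T : measurableType d) (J K : finType)
    (f : T -> J) (g : J -> K) : fin_measurable f -> fin_measurable (g \o f).
Proof. by move=> mf k; rewrite comp_preimage; exact: fin_measurable_preim. Qed.

Lemma fin_measurable_precomp d d' (T : measurableType d)
    (T' : measurableType d') (J : finType) (f : T' -> J) (h : T -> T') :
  measurable_fun setT h -> fin_measurable f -> fin_measurable (f \o h).
Proof.
by move=> mh mf j; rewrite comp_preimage -[X in measurable X]setTI; exact: mh.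
Qed.

Lemma fin_measurable_pair d (T : measurableType d) (J K : finType)
    (f : T -> J) (g : T -> K) : fin_measurable f -> fin_measurable g ->
  fin_measurable (fun x => (f x, g x)).
Proof.
move=> mf mg [j k]; rewrite [X in measurable X](_ : _ =
    f @^-1` [set j] `&` g @^-1` [set k]); first exact: measurableI.
by apply/seteqP; split=> x /= [-> ->].
Qed.

Lemma fin_measurable_ffun d (T : measurableType d) (K J : finType)
    (f : K -> T -> J) : (forall k, fin_measurable (f k)) ->
  fin_measurable (fun x => [ffun k => f k x]).
Proof.
move=> mf u; rewrite [X in measurable X](_ : _ =
    \big[setI/setT]_(k : K) f k @^-1` [set u k]).
  by apply: bigsetI_measurable => k _; exact: mf.
rewrite -bigcap_seq; apply/seteqP; split=> [x <- k _ /=|x ux /=].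
  by rewrite ffunE.
by apply/ffunP => k; rewrite ffunE; apply: ux; rewrite /= mem_index_enum.
Qed.

Context d (T : measurableType d) (R : realType) (P : probability T R).

Definition law (J : finType) (f : T -> J) (j : J) : R :=
  fine (P (f @^-1` [set j])).

Lemma law_ge0 (J : finType) (f : T -> J) j : 0 <= law f j.
Proof. exact: fine_ge0. Qed.

Lemma fine_probabilityU (A B : set T) : measurable A -> measurable B ->
  [disjoint A & B] -> fine (P (A `|` B)) = fine (P A) + fine (P B).
Proof.
move=> mA mB AB.
by rewrite measureU ?fineD ?fin_num_measure//; exact/disj_set2P.
Qed.

Lemma law_preim (J : finType) (f : T -> J) (Q : pred J) : fin_measurable f ->
  fine (P (f @^-1` [set j | Q j])) = \sum_(j | Q j) law f j.
Proof.
move=> mf; rewrite (_ : \sum_(j | Q j) _ = \sum_(j <- enum Q) law f j); last first.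
  by rewrite big_enum.
have -> : [set j | Q j] = [set` enum Q].
  by apply/seteqP; split=> j /=; rewrite mem_enum.
elim: (enum Q) (enum_uniq Q) => [_|j s IH /= /andP[js us]].
  rewrite big_nil [X in P X](_ : _ = set0) ?measure0//.
  by rewrite -subset0.
rewrite big_cons -IH// -fine_probabilityU//; last 2 first.
  exact: fin_measurable_preim.
  apply/disj_set2P; rewrite -preimage_setI [X in _ @^-1` X](_ : _ = set0).
    exact: preimage_set0.
  by rewrite -subset0 => k [/= -> kin]; rewrite kin in js.
congr (fine (P _)); rewrite -preimage_setU; congr (_ @^-1` _).
apply/seteqP; split=> k /=; rewrite in_cons.
  by move=> /orP[/eqP|]; [left|right].
by move=> [->|->]; rewrite ?eqxx ?orbT.
Qed.

Lemma law_comp (J K : finType) (f : T -> J) (g : J -> K) : fin_measurable f ->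
  law (g \o f) = fun k => \sum_(j | g j == k) law f j.
Proof.
move=> mf; apply/funext => k; rewrite -law_preim// /law comp_preimage.
by congr (fine (P (_ @^-1` _))); apply/seteqP; split=> j /= /eqP.
Qed.

Lemma law_sum (J : finType) (f : T -> J) : fin_measurable f ->
  \sum_j law f j = 1.
Proof.
move=> mf; rewrite -law_preim// [X in P X](_ : _ = setT).
  by rewrite probability_setT.
by apply/seteqP; split.
Qed.

Lemma law_le1 (J : finType) (f : T -> J) j : fin_measurable f -> law f j <= 1.
Proof.
move=> mf; rewrite -(law_sum mf) (bigD1 j)//= lerDl.
by apply: sumr_ge0 => *; exact: law_ge0.
Qed.

Lemma law_pairl (J K : finType) (f : T -> J) (g : T -> K) :
  fin_measurable f -> fin_measurable g ->
  law f = fun j => \sum_k law (fun x => (f x, g x)) (j, k).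
Proof.
move=> mf mg; apply/funext => j.
have -> : law f = law (fst \o (fun x => (f x, g x))) by [].
rewrite law_comp; last exact: fin_measurable_pair.
transitivity (\sum_(jk : J * K | (jk.1 == j) && true)
    law (fun x => (f x, g x)) (jk.1, jk.2)).
  by apply: eq_big => -[? ?]; rewrite ?andbT.
rewrite -(pair_big_dep (pred1 j) (fun _ _ => true)
   (fun j k => law (fun x => (f x, g x)) (j, k)))/=.
  by rewrite big_pred1_eq.
Qed.

Lemma law_pairr (J K : finType) (f : T -> J) (g : T -> K) :
  fin_measurable f -> fin_measurable g ->
  law g = fun k => \sum_j law (fun x => (f x, g x)) (j, k).
Proof.
move=> mf mg; rewrite (law_pairl mg mf); apply/funext => k.
apply: eq_bigr => j _; congr (fine (P _)).
by apply/seteqP; split=> x /= [-> ->].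
Qed.

Lemma entropy_law_ge0 (J : finType) (f : T -> J) : fin_measurable f ->
  0 <= entropy (law f).
Proof. by move=> mf; apply: entropy_ge0 => j; rewrite law_ge0 law_le1. Qed.

Lemma entropy_law_comp (J K : finType) (f : T -> J) (g : J -> K) :
  fin_measurable f -> entropy (law (g \o f)) <= entropy (law f).
Proof.
by move=> mf; rewrite law_comp//; apply: entropy_image; exact: law_ge0.
Qed.

Lemma entropy_law_pair (J K : finType) (f : T -> J) (g : T -> K) :
  fin_measurable f -> fin_measurable g ->
  entropy (law (fun x => (f x, g x))) <= entropy (law f) + entropy (law g).
Proof.
move=> mf mg; rewrite (law_pairl mf mg) (law_pairr mf mg).
rewrite [leLHS](_ : _ = entropy (fun jk : J * K =>
   law (fun x => (f x, g x)) (jk.1, jk.2))); last first.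
  by congr entropy; apply/funext => -[].
apply: entropy_joint; first by move=> *; exact: law_ge0.
by rewrite -[RHS](law_sum mf) [in RHS](law_pairl mf mg).
Qed.

Definition information (J K : finType) (f : T -> J) (g : T -> K) : R :=
  joint_information (fun j k => law (fun x => (f x, g x)) (j, k)).

Lemma informationE (J K : finType) (f : T -> J) (g : T -> K) :
  fin_measurable f -> fin_measurable g ->
  information f g = \sum_j \sum_k law (fun x => (f x, g x)) (j, k) *
    ln (law (fun x => (f x, g x)) (j, k) / (law f j * law g k)).
Proof. by move=> mf mg; rewrite (law_pairl mf mg) (law_pairr mf mg). Qed.

Lemma information_le_entropy (J K : finType) (f : T -> J) (g : T -> K) :
  fin_measurable f -> fin_measurable g ->
  information f g <= entropy (law g).
Proof.
move=> mf mg; rewrite (law_pairr mf mg).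
by apply: joint_information_le_entropy => *; exact: law_ge0.
Qed.

(** The mass of the joint table where coordinate [k] disagrees becomes the probability of misreading
    symbol [k]. *)
Lemma fano_law (I : finType) n (t : R) (f : T -> {ffun 'I_n -> I})
    (g : T -> {ffun 'I_n -> option I}) :
  0 < t < 1 -> (0 < #|I|)%N -> fin_measurable f -> fin_measurable g ->
  entropy (law f) <= information f g + (n%:R * - ln (1 - t) +
   (\sum_k fine (P [set x | g x k != Some (f x k)])) * ln (#|I|%:R / t)).
Proof.
move=> t01 I0 mf mg.
have mfg := fin_measurable_pair mf mg.
pose err k (fg : {ffun 'I_n -> I} * {ffun 'I_n -> option I}) :=
  fg.2 k != Some (fg.1 k).
rewrite [in leLHS](law_pairl mf mg).
apply: (le_trans (fano t01 I0 _ _)).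
- by move=> *; exact: law_ge0.
- by rewrite -[RHS](law_sum mf) [in RHS](law_pairl mf mg).
rewrite lerD2l lerD2l; set S := leLHS; rewrite [leRHS](_ : _ = S)// /S.
congr (_ * _); apply: eq_bigr => k _.
rewrite (_ : [set x | _] = (fun x => (f x, g x)) @^-1`
  [set fg | err k fg])//.
rewrite (law_preim (err k) mfg).
rewrite pair_bigA big_mkcond/=; apply: eq_bigr => -[a b] _; rewrite mulrb.
by [].
Qed.

End FiniteValued.

(** * Partitions as labels, and mutual information as a supremum over labels *)

Section MutualInformationLabels.

(** The label of a point is the index of its cell, unique by disjointness. Labels, unlike cells,
    compose with random variables. *)
Lemma finite_partition_label d (M : measurableType d) m (A : 'I_m -> set M) :
  finite_partition A -> exists2 a : M -> 'I_m,
    fin_measurable a & A = fun i => a @^-1` [set i].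
Proof.
move=> [mA tA UA].
have /choice[a Aa] x : exists i, A i x.
  by have : [set: M] x by []; rewrite -UA => -[i _ Ax]; exists i.
have AE : A = fun i => a @^-1` [set i].
  apply/funext => i; apply/seteqP; split=> x /= => [Aix|<-//].
  by apply: (tA _ _ I I); exists x.
by exists a => // i; move: (mA i); rewrite AE.
Qed.

Lemma label_finite_partition d (M : measurableType d) m (a : M -> 'I_m) :
  fin_measurable a -> finite_partition (fun i => a @^-1` [set i]).
Proof.
move=> ma; split => //.
  by move=> i j _ _ [x [/= <- <-]].
by apply/seteqP; split=> x // _; exists (a x).
Qed.

Context d d1 d2 (Omega : measurableType d) (M : measurableType d1)
  (N : measurableType d2) (R : realType) (P : probability Omega R)
  (xi : {RV P >-> M}) (eta : {RV P >-> N}).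

Lemma partition_information_label m n (a : M -> 'I_m) (b : N -> 'I_n) :
  fin_measurable a -> fin_measurable b ->
  partition_information P xi eta (fun i => a @^-1` [set i])
    (fun j => b @^-1` [set j]) = information P (a \o xi) (b \o eta).
Proof.
move=> ma mb; rewrite informationE.
- apply: eq_bigr => i _; apply: eq_bigr => j _ /=.
  rewrite /law -!comp_preimage (_ : _ `&` _ =
   (fun x => (a (xi x), b (eta x))) @^-1` [set (i, j)])//.
  by apply/seteqP; split=> x /= [-> ->].
- exact: fin_measurable_precomp.
- exact: fin_measurable_precomp.
Qed.

Lemma mutual_information_le (c : \bar R) :
  (forall m n (a : M -> 'I_m) (b : N -> 'I_n),
    fin_measurable a -> fin_measurable b ->
    ((information P (a \o xi) (b \o eta))%:E <= c)%E) ->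
  (mutual_information xi eta <= c)%E.
Proof.
move=> Ic; apply: ge_ereal_sup => _ [m [n [A [B [Ap Bp ->]]]]].
have [a ma ->] := finite_partition_label Ap.
have [b mb ->] := finite_partition_label Bp.
by rewrite partition_information_label//; exact: Ic.
Qed.

(** The supremum runs over partitions indexed by ordinals; [enum_rank] recodes other finite
    alphabets without changing the information. *)
Lemma information_le_mutual (I J : finType) (a : M -> I) (b : N -> J) :
  fin_measurable a -> fin_measurable b ->
  ((information P (a \o xi) (b \o eta))%:E <= mutual_information xi eta)%E.
Proof.
move=> ma mb; apply: ereal_sup_ubound.
have ma' := fin_measurable_comp enum_rank ma.
have mb' := fin_measurable_comp enum_rank mb.
exists #|I|, #|J|, (fun i => (enum_rank \o a) @^-1` [set i]),
  (fun j => (enum_rank \o b) @^-1` [set j]).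
split; try exact: label_finite_partition.
rewrite partition_information_label// !informationE; last 4 first.
- exact: fin_measurable_precomp.
- exact: fin_measurable_precomp.
- exact: fin_measurable_precomp.
- exact: fin_measurable_precomp.
have inj (K : finType) (f : Omega -> K) k :
    law P (enum_rank \o f) (enum_rank k) = law P f k.
  congr (fine (P _)); apply/seteqP; split=> x /= => [/enum_rank_inj//|->//].
congr EFin; rewrite [RHS](reindex _ (onW_bij _ (@enum_rank_bij I)))/=.
apply: eq_bigr => i _.
rewrite [RHS](reindex _ (onW_bij _ (@enum_rank_bij J)))/=.
apply: eq_bigr => j _; rewrite -(inj _ (a \o xi)) -(inj _ (b \o eta)).
rewrite (_ : law P (fun x => (a (xi x), b (eta x))) (i, j) =
  law P (fun x => (enum_rank (a (xi x)), enum_rank (b (eta x))))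
    (enum_rank i, enum_rank j))//.
congr (fine (P _)); apply/seteqP; split=> x /=.
  by move=> [-> ->].
by move=> [/enum_rank_inj -> /enum_rank_inj ->].
Qed.

End MutualInformationLabels.

(** The limit is the infimum of the ratios. Euclidean division [n = q * N + r] by an almost optimal
    [N] gives [u n <= q * u N + u r], where the last term is bounded. *)
Lemma fekete (R : realType) (u : nat -> R) :
  (forall n, 0 <= u n) -> (forall m n, u (m + n)%N <= u m + u n) ->
  exists2 l : R, (u n / n%:R @[n --> \oo] --> l) &
    forall n, (0 < n)%N -> l <= u n / n%:R.
Proof.
move=> u0 usub.
pose S := [set u n / n%:R | n in [set n | (0 < n)%N]].
have hS : has_inf S.
  split; first by exists (u 1 / 1); exists 1%N.
  by exists 0 => _ [n n0 <-]; rewrite divr_ge0.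
have Sl n : (0 < n)%N -> inf S <= u n / n%:R.
  by move=> n0; apply: (ge_inf hS.2); exists n.
exists (inf S) => //; apply/cvgrPdist_lt => e e0.
have e20 : 0 < e / 2 by rewrite divr_gt0.
have [_ [N N0 <-] uN] := inf_adherent e20 hS.
have NR : 0 < N%:R :> R by rewrite ltr0n.
have usubM q r : u (q * N + r)%N <= q%:R * u N + u r.
  elim: q => [|q IH]; first by rewrite mul0n add0n mul0r add0r.
  rewrite mulSn -addnA (le_trans (usub _ _))// -nat1r mulrDl mul1r -addrA.
  by rewrite lerD2l.
pose C := \sum_(r < N) u r.
near=> n.
have n0 : (0 < n)%N by near: n; exact: nbhs_infty_gt.
have nR : 0 < n%:R :> R by rewrite ltr0n.
rewrite distrC ger0_norm ?subr_ge0 ?Sl// ltrBlDr.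
have ur : u (n %% N)%N <= C.
  rewrite /C (bigD1 (Ordinal (ltn_pmod n N0)))//= lerDl; exact: sumr_ge0.
have un : u n <= (n %/ N)%:R * u N + C.
  by rewrite {1}(divn_eq n N) (le_trans (usubM _ _))// lerD2l.
have qn : (n %/ N)%:R * u N <= n%:R * (u N / N%:R).
  rewrite mulrCA mulrC ler_wpM2l// ler_pdivlMr// -natrM ler_nat.
  exact: leq_divM.
have Cn : C < n%:R * (e / 2).
  rewrite -ltr_pdivrMr//; near: n; exact: nbhs_infty_gtr.
rewrite ltr_pdivrMr//.
have : n%:R * (u N / N%:R) < n%:R * (inf S + e / 2) by rewrite ltr_pM2l.
move: un qn Cn; set x := n%:R; set y := u N / _; set z := _ * u N.
lra.
Unshelve. all: by end_near. Qed.

(** * Itineraries and the entropy of a partition along the dynamics *)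

Section Itinerary.
Context d (X : measurableType d) (R : realType) (mu : probability X R)
  (T : X -> X).

Definition itinerary (I : Type) (a : X -> I) n (x : X) : {ffun 'I_n -> I} :=
  [ffun k : 'I_n => a (iter k T x)].

Lemma join_cell_label m (a : X -> 'I_m) n :
  @join_cell d X T m (fun i => a @^-1` [set i]) n =
  fun f : {ffun 'I_n -> 'I_m} => itinerary a n @^-1` [set f].
Proof.
apply/funext => f; apply/seteqP; split=> x /=.
  by move=> af; apply/ffunP => k; rewrite ffunE; exact: af.
by move=> <- k _; rewrite /= ffunE.
Qed.

Lemma partition_entropy_label m (a : X -> 'I_m) n :
  partition_entropy mu (@join_cell d X T m (fun i => a @^-1` [set i]) n) =
  entropy (law mu (itinerary a n)).
Proof. by rewrite join_cell_label. Qed.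

Hypotheses (mT : measurable_fun setT T) (iT : invariant_measure mu T).

Lemma measurable_iter n : measurable_fun setT (iter n T).
Proof.
elim: n => [|n IH]; first exact: measurable_id.
by rewrite (_ : iter n.+1 T = T \o iter n T)//; exact: measurableT_comp.
Qed.

Lemma measure_preimage_iter n A : measurable A ->
  mu (iter n T @^-1` A) = mu A.
Proof.
move=> mA; elim: n => // n <-.
rewrite -[RHS]iT; last by rewrite -[X in measurable X]setTI; exact: measurable_iter.
by congr (mu _); apply/seteqP; split=> x /=; rewrite -iterS iterSr.
Qed.

Lemma fin_measurable_itinerary (I : finType) (a : X -> I) n :
  fin_measurable a -> fin_measurable (itinerary a n).
Proof.
move=> ma; apply: (fin_measurable_ffun (f := fun k : 'I_n => a \o iter k T)).
by move=> k; apply: fin_measurable_precomp => //; exact: measurable_iter.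
Qed.

(** A word of length [m + n] is read off from the first [m] symbols of [x] and the first [n] symbols
    of [T^m x]; by invariance the latter have the law of an [n]-step itinerary. *)
Lemma entropy_itineraryD (I : finType) (a : X -> I) m n : fin_measurable a ->
  entropy (law mu (itinerary a (m + n))) <=
  entropy (law mu (itinerary a m)) + entropy (law mu (itinerary a n)).
Proof.
move=> ma.
have mm := fin_measurable_itinerary (n := m) ma.
have mn := fin_measurable_itinerary (n := n) ma.
have mnT := fin_measurable_precomp (measurable_iter m) mn.
have <- : law mu (itinerary a n \o iter m T) = law mu (itinerary a n).
  apply/funext => f.
  by rewrite /law comp_preimage measure_preimage_iter.
pose g (uv : {ffun 'I_m -> I} * {ffun 'I_n -> I}) : {ffun 'I_(m + n) -> I} :=
  [ffun k => match fintype.split k with inl i => uv.1 i | inr j => uv.2 j end].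
have -> : itinerary a (m + n) =
    g \o (fun x => (itinerary a m x, (itinerary a n \o iter m T) x)).
  apply/funext => x; apply/ffunP => k; rewrite !ffunE.
  case: splitP => [i ki|j kj]; rewrite !ffunE /=; first by rewrite ki.
  by rewrite kj addnC iterD.
apply: (le_trans (entropy_law_comp _ _ _)); first exact: fin_measurable_pair.
exact: entropy_law_pair.
Qed.

(** Fekete's lemma shows that the [limn] in the definition is a true limit and bounds every term
    from below; the latter serves the Fano estimate, where [n] is fixed. *)
Lemma partition_ks_entropy_cvg m (a : X -> 'I_m) : fin_measurable a ->
  let h := partition_ks_entropy mu T (fun i => a @^-1` [set i]) in
  (entropy (law mu (itinerary a n)) / n%:R @[n --> \oo] --> h) /\
  (forall n, (0 < n)%N -> h <= entropy (law mu (itinerary a n)) / n%:R).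
Proof.
move=> ma /=.
have [l ul lu] := @fekete R (fun n => entropy (law mu (itinerary a n)))
  (fun n => entropy_law_ge0 mu (fin_measurable_itinerary (n := n) ma))
  (fun m n => entropy_itineraryD m n ma).
suff -> : partition_ks_entropy mu T (fun i => a @^-1` [set i]) = l by [].
rewrite /partition_ks_entropy; under eq_fun do rewrite partition_entropy_label.
exact/cvg_lim.
Qed.

End Itinerary.

(** * Regularity of Borel probability measures and prediction of labels from nearby points *)

Section BorelQuantizer.
Context (R : realType) (X : pmetricType R).

Lemma borel_open (A : set X) : open A -> measurable (A : set (borel X)).
Proof. by move=> oA; exact: sub_sigma_algebra. Qed.

Lemma continuous_borel_measurable (T : X -> X) : continuous T ->
  measurable_fun setT (T : borel X -> borel X).
Proof.
move=> /continuousP cT; apply: (@measurability _ _ (borel X) (borel X) _ _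
  (@open X)) => //.
by move=> _ [A oA <-]; rewrite setTI; apply: borel_open; exact: cT.
Qed.

Lemma open_mdist_lt (x : X) e : open [set y | mdist x y < e].
Proof.
rewrite openE => y /= xy; rewrite /interior -nbhs_ballE.
exists (e - mdist x y) => /=; first by rewrite subr_gt0.
move=> z; rewrite ballEmdist /= => yz.
by rewrite (le_lt_trans (metric_triangle _ y _))// addrC -ltrBrDr.
Qed.

Lemma measure_decreasing_lt d (T : measurableType d) (mu : probability T R)
    (F : nat -> set T) (e : R) :
  (forall n, measurable (F n)) -> \bigcap_n F n = set0 ->
  {homo F : n m / (n <= m)%N >-> (m <= n)%O} -> 0 < e ->
  exists n, (mu (F n) < e%:E)%E.
Proof.
move=> mF F0 dF e0; apply: contrapT => /forallNP Fe.
have cF : (mu \o F) x @[x --> \oo] --> mu (\bigcap_n F n).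
  apply: nonincreasing_cvg_mu => //; last by rewrite F0.
  by rewrite ltey_eq fin_num_measure.
have : (e%:E <= mu (\bigcap_n F n))%E.
  apply: (cvge_to_ge cF); apply: nearW => n; rewrite leNgt.
  exact/negP/Fe.
by rewrite F0 measure0 lee_fin leNgt e0.
Qed.

Variable mu : probability (borel X) R.

(* A Lusin-type regularity of Borel sets.  Unlike approximation by closed and
   open sets, it is visibly stable under complements. *)
Definition uniformly_clopen (A : set X) := forall dlt : R, 0 < dlt ->
  exists e (K : set (borel X)), [/\ 0 < e, measurable K,
    (mu (~` K) < dlt%:E)%E &
    forall x y, K x -> K y -> mdist x y < e -> A x -> A y].


Lemma uniformly_clopenC A : uniformly_clopen A -> uniformly_clopen (~` A).
Proof.
move=> uA dlt /uA[e [K [e0 mK Kd AK]]]; exists e, K; split => // x y Kx Ky xy nAx.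
by move=> Ay; apply: nAx; apply: (AK y x) => //; rewrite metric_sym.
Qed.

(** [A] is exhausted by the points whose distance to the complement is bounded below, so removing a
    thin inner collar of [A] loses little mass. *)
Lemma uniformly_clopen_open A : open A -> uniformly_clopen A.
Proof.
move=> oA dlt d0.
pose F n : set (borel X) := [set x | forall y, ~ A y -> n.+1%:R^-1 <= mdist x y].
have mF n : measurable (F n).
  rewrite -[F n]setCK; apply: measurableC.
  rewrite [X in measurable X](_ : _ =
      \bigcup_(y in ~` A) [set x | mdist y x < n.+1%:R^-1]).
    by apply: borel_open; apply: bigcup_open => y _; exact: open_mdist_lt.
  apply/seteqP; split=> x /=.
    move=> /existsNP[y /not_implyP[nAy /negP]]; rewrite -ltNge => xy.
    by exists y => //=; rewrite metric_sym.
  move=> [y nAy /= yx] /(_ y nAy); rewrite leNgt => /negP; apply.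
  by rewrite metric_sym.
have mA : measurable (A : set (borel X)) by exact: borel_open.
have [||||n nd] := @measure_decreasing_lt _ _ mu (fun n => A `\` F n) dlt.
- by move=> n; exact: measurableD.
- rewrite -subset0 => x Ax.
  have [Ax0 _] := Ax 0%N I.
  have : nbhs x A by exact: open_nbhs_nbhs.
  rewrite -nbhs_ballE => -[e /= e0]; rewrite ballEmdist => eA.
  have [n _ /(_ n (leqnn n)) ne] := near_infty_natSinv_lt (PosNum e0).
  have [_] := Ax n I; apply => y nAy.
  rewrite leNgt; apply/negP => xy; apply: nAy; apply: eA => /=.
  exact: lt_trans ne.
- move=> m n mn; apply/subsetPset; apply: setDS => x Fx y nAy.
  by rewrite (le_trans _ (Fx y nAy))// lef_pV2 ?posrE// ler_nat ltnS.
- exact: d0.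
(* Only the part of [A] outside [F n] is removed; a remaining point of [A] lies in [F n], hence is
   far from the complement. *)
exists n.+1%:R^-1, (F n `|` ~` A); split=> //.
- by apply: measurableU => //; exact: measurableC.
- by rewrite setCU setCK setIC -setDE.
move=> x y [Fx|nAx] _ xy Ax //.
by apply: contrapT => /Fx; rewrite leNgt xy.
Qed.

Lemma exists_lower_bound (f : nat -> R) N : (forall n, 0 < f n) ->
  exists2 e, 0 < e & forall n, (n < N)%N -> e <= f n.
Proof.
move=> f0; elim: N => [|N [e e0 ef]]; first by exists 1.
exists (Num.min e (f N)); first by rewrite lt_min e0 f0.
move=> n; rewrite ltnS leq_eqVlt => /predU1P[->|nN]; rewrite ge_min ?lexx ?orbT//.
by rewrite ef.
Qed.

(** Intersecting the good sets of all [A n] costs half of the budget; discarding what the first [N]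
    members of the union miss costs the other half. Only finitely many radii then matter, and they
    have a positive lower bound. *)
Lemma uniformly_clopen_bigcup (A : nat -> set X) :
  (forall n, measurable (A n : set (borel X))) ->
  (forall n, uniformly_clopen (A n)) -> uniformly_clopen (\bigcup_n A n).
Proof.
move=> mA uA dlt d0; pose d2 := dlt / 2.
have d20 : 0 < d2 by rewrite divr_gt0.
have /choice[eK eKP] n : exists eK : R * set (borel X), [/\ 0 < eK.1,
    measurable eK.2, (mu (~` eK.2) < (d2 / (2 ^ n.+1)%:R)%:E)%E &
    forall x y, eK.2 x -> eK.2 y -> mdist x y < eK.1 -> A n x -> A n y].
  have [|e [K ?]] := uA n (d2 / (2 ^ n.+1)%:R); last by exists (e, K).
  by rewrite divr_gt0// ltr0n expn_gt0.
pose U N : set (borel X) := \bigcup_(n in `I_N) A n.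
have mU N : measurable (U N) by apply: bigcup_measurable.
have mUA : measurable (\bigcup_n A n : set (borel X)) by exact: bigcup_measurable.
have [||||N Nd] := @measure_decreasing_lt _ _ mu
    (fun n => \bigcup_n A n `\` U n) d2.
- by move=> n; exact: measurableD.
- rewrite -subset0 => x Ax; have [[n _ Anx] _] := Ax 0%N I.
  by have [_] := Ax n.+1 I; apply; exists n => /=.
- move=> m n mn; apply/subsetPset; apply: setDS => x [k /= km Ax].
  by exists k => //=; exact: leq_trans km mn.
- exact: d20.
have [e e0 eN] := @exists_lower_bound (fun n => (eK n).1) N
  (fun n => let: And4 h _ _ _ := eKP n in h).
have mK n : measurable (eK n).2 by have [] := eKP n.
exists e, (\bigcap_n (eK n).2 `\` (\bigcup_n A n `\` U N)); split => //.
- apply: measurableD; first exact: bigcapT_measurable.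
  exact: measurableD.
- rewrite setDE setCI setCK setC_bigcap.
  apply: (@le_lt_trans _ _ (mu (\bigcup_n ~` (eK n).2) +
      mu (\bigcup_n A n `\` U N))%E).
    apply: measureU2; last exact: measurableD.
    by apply: bigcup_measurable => n _; exact: measurableC.
  rewrite [dlt]splitr EFinD -/d2; apply: lee_ltD => //.
    apply: fin_num_measure; apply: bigcup_measurable => n _.
    exact: measurableC.
  apply: (@le_trans _ _ (\sum_(0 <= n <oo) mu (~` (eK n).2))%E).
    apply: measure_sigma_subadditive => //.
    + by move=> n; exact: measurableC.
    + by apply: bigcup_measurable => n _; exact: measurableC.
  (* The summand [0] matches the shape of [epsilon_trick], which sums the geometric errors. *)
  apply: (@le_trans _ _ (\sum_(0 <= n <oo) (0 + (d2 / (2 ^ n.+1)%:R)%:E))%E).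
    by apply: lee_nneseries => // n _; rewrite add0e ltW//; have [] := eKP n.
  apply: (le_trans (epsilon_trick _ _ (ltW d20))) => //.
  by rewrite eseries0// add0e.
move=> x y [Kx Ux] [Ky _] xy Ax.
have [n /= nN Anx] : U N x by apply: contrapT => nU; exact: Ux.
exists n => //; have [_ _ _ h] := eKP n.
apply: (h x y) => //; [exact: Kx|exact: Ky|].
by apply: (lt_le_trans xy); exact: eN.
Qed.

(** The measurable sets with this property form a sigma-algebra containing the open sets.
    Measurability is carried along for the step of countable unions. *)
Lemma borel_uniformly_clopen (A : set (borel X)) :
  measurable A -> uniformly_clopen A.
Proof.
move=> mA.
suff : (@open X).-sigma.-measurable `<=`
   [set B | measurable (B : set (borel X)) /\ uniformly_clopen B].
  by move=> /(_ _ mA)[].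
apply: smallest_sub; last first.
  by move=> B oB; split; [exact: borel_open|exact: uniformly_clopen_open].
split.
- split; first exact: measurable0.
  by apply: uniformly_clopen_open; exact: open0.
- move=> B [mB uB]; split; first exact: measurableD.
  by rewrite setTD; exact: uniformly_clopenC.
- move=> B mB; split; first by apply: bigcup_measurable => n _; have [] := mB n.
  by apply: uniformly_clopen_bigcup => n; have [] := mB n.
Qed.

(** Values are treated one at a time: the good sets are intersected, the smaller radius is kept and
    the budget is halved. *)
Lemma label_uniformly_continuous (I : finType) (a : borel X -> I) (dlt : R) :
  fin_measurable a -> 0 < dlt ->
  exists e (K : set (borel X)), [/\ 0 < e, measurable K,
    (mu (~` K) < dlt%:E)%E &
    forall x y, K x -> K y -> mdist (x : X) y < e -> a x = a y].
Proof.
move=> ma.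
suff H (s : seq I) : forall dlt, 0 < dlt ->
  exists e (K : set (borel X)), [/\ 0 < e, measurable K,
    (mu (~` K) < dlt%:E)%E &
    forall x y, K x -> K y -> mdist (x : X) y < e -> a x \in s -> a x = a y].
  move=> /(H (enum I))[e [K [e0 mK Kd aK]]]; exists e, K; split=> // x y Kx Ky xy.
  by apply: aK => //; rewrite mem_enum.
elim: s => [|i s IH] {}dlt d0.
  exists 1, setT; split=> //.
  by rewrite setCT measure0 lte_fin.
have d20 : 0 < dlt / 2 by rewrite divr_gt0.
have [e1 [K1 [e10 mK1 K1d aK1]]] := IH _ d20.
have [e2 [K2 [e20 mK2 K2d aK2]]] := borel_uniformly_clopen (ma i) d20.
exists (Num.min e1 e2), (K1 `&` K2); split.
- by rewrite lt_min e10.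
- exact: measurableI.
- rewrite setCI [dlt]splitr EFinD.
  apply: (le_lt_trans (measureU2 _ _ _)); try exact: measurableC.
  by apply: lteD.
move=> x y [K1x K2x] [K1y K2y]; rewrite lt_min => /andP[xy1 xy2].
rewrite in_cons => /predU1P[axi|]; last exact: aK1.
by rewrite axi; apply/esym/(aK2 x y).
Qed.

(** Balls of radius [e / 2] around points of [K] with different labels are disjoint, so a point of
    such a ball reveals the label. The predictor [b] is defined inside and outside [K], and answers
    [None] away from these balls. *)
Lemma approximate_label (I : finType) (a : borel X -> I) (dlt : R) :
  fin_measurable a -> 0 < dlt ->
  exists e (K : set (borel X)) (b : borel X -> option I),
  [/\ 0 < e, measurable K, (mu (~` K) < dlt%:E)%E, fin_measurable b &
    forall x y, K x -> mdist (x : X) y < e -> b y = Some (a x)].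
Proof.
move=> ma d0; have [e [K [e0 mK Kd aK]]] := label_uniformly_continuous ma d0.
pose U i : set (borel X) :=
  \bigcup_(x in [set x | K x /\ a x = i]) [set y | mdist (x : X) y < e / 2].
have mU i : measurable (U i).
  by apply: borel_open; apply: bigcup_open => x _; exact: open_mdist_lt.
have Uinj i j y : U i y -> U j y -> i = j.
  move=> [x [Kx <-] /= xy] [z [Kz <-] /= zy]; apply: aK => //.
  rewrite (le_lt_trans (metric_triangle _ y _))// [e]splitr ltrD//.
  by rewrite metric_sym.
pose b y := [pick i | `[< U i y >]].
have bP i y : U i y -> b y = Some i.
  move=> Uiy; rewrite /b; case: pickP => [j /asboolP Ujy|/(_ i)].
    by rewrite (Uinj _ _ _ Uiy Ujy).
  by move/asboolP.
have bS i y : b y = Some i -> U i y.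
  by rewrite /b; case: pickP => // j /asboolP Ujy [<-].
exists (e / 2), K, b; split=> //; first by rewrite divr_gt0.
  have mbS i : measurable (b @^-1` [set Some i]).
    rewrite (_ : b @^-1` _ = U i)//.
    by apply/seteqP; split=> y /=; [exact: bS|exact: bP].
  case=> [i|]//.
  rewrite [X in measurable X](_ : _ = ~` \bigcup_(i in setT) b @^-1` [set Some i]).
    by apply: measurableC; apply: fin_bigcup_measurable.
  apply/seteqP; split=> y /= => [byN [i _ /=]|nby]; first by rewrite byN.
  case by_: (b y) => [i|//]; exfalso; apply: nby; exists i => //.
by move=> x y Kx xy; apply: bP; exists x.
Qed.

End BorelQuantizer.

(** * Expected distortion against probabilities of bad coordinates *)

Section Expectation.
Context d (Omega : measurableType d) (R : realType) (P : probability Omega R).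

(* Unlike [ge0_le_integral], no measurability is required: the distortions
   below need not be measured through the product sigma-algebra. *)
Lemma ge0_le_integralT (f g : Omega -> \bar R) :
  (forall w, 0 <= f w)%E -> (forall w, f w <= g w)%E ->
  (\int[P]_w f w <= \int[P]_w g w)%E.
Proof.
move=> f0 fg; rewrite !ge0_integralTE//; last first.
  by move=> w; exact: le_trans (fg w).
apply: le_ereal_sup => _ [h /= hf <-]; exists h => //= w.
exact: le_trans (fg w).
Qed.

(** A counting form of Markov's inequality: [F] dominates a simple function whose integral is
    explicit. *)
Lemma expectation_ge_sum_prob n (B : 'I_n -> set Omega) (c : R)
    (F : Omega -> R) : 0 <= c -> (forall k, measurable (B k)) ->
  (forall w, c * \sum_k \1_(B k) w <= F w) ->
  ((c * \sum_k fine (P (B k)))%:E <= 'E_P[F])%E.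
Proof.
move=> c0 mB cF; rewrite expectation.unlock.
have mI k : measurable_fun setT (EFin \o (fun w => c * \1_(B k) w)).
  apply/measurable_EFinP; exact: measurable_funM.
apply: (@le_trans _ _ (\int[P]_w \sum_(k < n) (c * \1_(B k) w)%:E)%E); last first.
  apply: ge0_le_integralT => w.
    by apply: sume_ge0 => k _; rewrite lee_fin mulr_ge0.
  by rewrite sumEFin lee_fin -mulr_sumr.
rewrite ge0_integral_sum//; last by move=> k w _; rewrite lee_fin mulr_ge0.
rewrite mulr_sumr -sumEFin; apply: lee_sum => k _.
under eq_integral do rewrite EFinM.
rewrite ge0_integralZl_EFin//; last by apply/measurable_EFinP; exact: measurable_indic.
by rewrite integral_indic// setIT EFinM fineK ?fin_num_measure.
Qed.

Lemma sum_prob_lt n (B : 'I_n -> set Omega) (c b : R) (F : Omega -> R) :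
  0 <= c -> (forall k, measurable (B k)) -> ('E_P[F] < b%:E)%E ->
  (forall w, c * \sum_k \1_(B k) w <= F w) ->
  c * \sum_k fine (P (B k)) < b.
Proof.
move=> c0 mB Fb cF; rewrite -lte_fin; apply: le_lt_trans Fb.
exact: expectation_ge_sum_prob.
Qed.

Lemma expectation_le_cst (F : Omega -> R) (c : R) :
  (forall w, 0 <= F w <= c) -> ('E_P[F] <= c%:E)%E.
Proof.
move=> Fc; rewrite expectation.unlock.
apply: (@le_trans _ _ (\int[P]_w c%:E)%E).
  by apply: ge0_le_integralT => w; rewrite lee_fin; have /andP[] := Fc w.
by rewrite integral_cst//= probability_setT mule1.
Qed.

End Expectation.

(** * The Fano lower bound and the quantization upper bound *)

Section Bounds.
Context (R : realType) (X : pmetricType R) (T : borel X -> borel X)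
  (mu : probability (borel X) R).
Hypotheses (mT : measurable_fun setT T)
  (iT : invariant_measure mu T).

(** The point is uniformity: [c] and [s] depend on [a] and [dlt], but not on [n] or on the coupling
    of [xi] and [eta]. Large distortion enters through measurable events [B k] on which it occurs,
    which suits all three distortion conditions. *)
Lemma entropy_le_mutual_information (I : finType) (a : borel X -> I) (dlt : R) :
  fin_measurable a -> 0 < dlt -> exists c s : R, [/\ 0 < c, 0 < s &
  forall d (Omega : measurableType d) (P : probability Omega R) n
    (xi : {RV P >-> borel X}) (eta : {RV P >-> n.-tuple (borel X)}),
    (forall A, measurable A -> distribution P xi A = mu A) ->
    (forall B : 'I_n -> set Omega, (forall k, measurable (B k)) ->
      (forall k w, B k w ->
         c <= mdist (iter k T (xi w) : X) (tnth (eta w) k : X)) ->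
      \sum_k fine (P (B k)) <= s * n%:R) ->
    ((entropy (law mu (itinerary T a n)) - n%:R * dlt)%:E <=
      mutual_information xi eta)%E].
Proof.
move=> ma d0.
(* This makes [- ln (1 - t)] equal to [dlt / 2], half of the allowed loss per symbol; [s] below
   makes [2 * s * |L|] at most the other half. *)
pose t := 1 - expR (- (dlt / 2)).
pose L := ln (#|I|%:R / t).
pose s := dlt / (4 * (`|L| + 1)).
have s0 : 0 < s by rewrite divr_gt0// mulr_gt0// ltr_wpDl.
have t01 : 0 < t < 1.
  by rewrite /t subr_gt0 expR_lt1 oppr_lt0 divr_gt0//= gtrBl expR_gt0.
have I0 : (0 < #|I|)%N by apply/card_gt0P; exists (a (point : X)).
have [c [K [b [c0 mK Ks mb bK]]]] := approximate_label mu ma s0.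
exists c, s; split => // d Omega P n xi eta xi_mu Bs.
pose f := itinerary T a n \o xi.
pose bn (y : n.-tuple (borel X)) : {ffun 'I_n -> option I} :=
  [ffun k => b (tnth y k)].
have mbn : fin_measurable bn.
  apply: (fin_measurable_ffun (f := fun (k : 'I_n) => b \o tnth (T := borel X) ^~ k)).
  move=> k; apply: fin_measurable_precomp => //; exact: measurable_tnth.
have mit : fin_measurable (itinerary T a n) by exact: fin_measurable_itinerary.
have mf : fin_measurable f by exact: fin_measurable_precomp.
have mg : fin_measurable (bn \o eta) by exact: fin_measurable_precomp.
apply: le_trans (information_le_mutual xi eta mit mbn).
rewrite lee_fin lerBlDr.
have <- : law P f = law mu (itinerary T a n).
  by apply/funext => u; rewrite /law -xi_mu.
apply: (le_trans (fano_law P t01 I0 mf mg)); rewrite lerD2l.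
rewrite -/L.
have -> : - ln (1 - t) = dlt / 2 by rewrite /t opprB addrC subrK expRK opprK.
pose E k : set Omega := [set w | (bn \o eta) w k != Some (f w k)].
pose K' (k : 'I_n) : set Omega := (iter k T \o xi) @^-1` K.
have mK' k : measurable (K' k).
  rewrite -[X in measurable X]setTI.
  apply: (measurableT_comp (measurable_iter mT k) _) => //.
have mE k : measurable (E k).
  exact: (fin_measurable_preim
    [set uv : {ffun 'I_n -> I} * {ffun 'I_n -> option I} | uv.2 k != Some (uv.1 k)]
    (fin_measurable_pair mf mg)).
(* A misread symbol has two possible causes: [T^k xi] lies outside [K], of probability less than [s]
   by invariance, or it lies in [K] and the distortion is at least [c], which the hypothesis
   controls. *)
have EB : \sum_k fine (P (E k)) <= 2 * s * n%:R.
  have -> : 2 * s * n%:R = s * n%:R + s * n%:R by ring.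
  apply: (@le_trans _ _ (\sum_k (fine (P (E k `&` K' k)) + s))).
    apply: ler_sum => k _.
    rewrite -lee_fin EFinD !fineK ?fin_num_measure//; last exact: measurableI.
    apply: (@le_trans _ _ (P (E k `&` K' k) + P (~` K' k))%E).
      apply: le_trans (measureU2 _ _ _); last 2 first.
      - exact: measurableI.
      - exact: measurableC.
      apply: le_measure; rewrite ?inE//.
        by apply: measurableU; [exact: measurableI|exact: measurableC].
      by move=> w Ew; have [K'w|] := pselect (K' k w); [left|right].
    rewrite leeD2l// ltW// (le_lt_trans _ Ks)//.
    rewrite -(measure_preimage_iter mT iT k (measurableC mK)) -xi_mu//.
    rewrite -[X in measurable X]setTI; apply: measurable_iter => //.
    exact: measurableC.
  rewrite big_split/= sumr_const card_ord -[s *+ n]mulr_natr lerD2r.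
  apply: Bs => [k|k w [Ew K'w]]; first exact: measurableI.
  rewrite leNgt; apply/negP => lec; move: Ew.
  by rewrite /E/= /f/= !ffunE (bK _ _ K'w lec) eqxx.
have : (\sum_k fine (P (E k))) * L <= 2 * s * n%:R * `|L|.
  apply: (@le_trans _ _ ((\sum_k fine (P (E k))) * `|L|)).
    by rewrite ler_wpM2l ?ler_norm// sumr_ge0// => k _; exact: fine_ge0.
  by rewrite ler_wpM2r.
have sL : 2 * s * `|L| <= dlt / 2.
  rewrite /s; set l := `|L|; have l0 : 0 <= l by exact: normr_ge0.
  have -> : 2 * (dlt / (4 * (l + 1))) * l = dlt / 2 * (l / (l + 1)).
    by field; rewrite gt_eqF// ltr_wpDl.
  by rewrite ler_piMr ?divr_ge0 ?(ltW d0)// ler_pdivrMr ?ltr_wpDl// mul1r lerDl.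
have : 2 * s * n%:R * `|L| <= n%:R * (dlt / 2).
  by rewrite mulrAC mulrC ler_wpM2l.
rewrite -/(E _); set SL := _ * L; set Z := _ * `|L|; lra.
Qed.

(** The label records membership in every ball of a finite subcover, so it is measurable; a center
    is then read off from the label alone. *)
Lemma small_labels (e : R) : compact [set: X] -> 0 < e ->
  exists N (c : 'I_N -> X) (a : borel X -> 'I_N), fin_measurable a /\
    forall x : X, mdist x (c (a x)) < e.
Proof.
rewrite compact_cover => cX e0.
have [|x _|D _ XD] := cX X setT (fun x => [set y | mdist x y < e]).
- by move=> x _; exact: open_mdist_lt.
- by exists x => //=; rewrite mdistxx.
pose u (x : borel X) : {ffun D -> bool} :=
  [ffun i : D => mdist (val i : X) x < e].
(* The default [point] is never reached at the label of an actual point, as the balls cover [X]. *)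
pose c (v : {ffun D -> bool}) : X :=
  if [pick i | v i] is Some i then val i else point.
have mfu : fin_measurable u.
  apply: (fin_measurable_ffun (f := fun (i : D) (x : borel X) =>
    mdist (val i : X) x < e)) => i.
  have mi : measurable ([set x | mdist (val i : X) x < e] : set (borel X)).
    by apply: borel_open; exact: open_mdist_lt.
  case.
    by rewrite (_ : _ @^-1` _ = [set x | mdist (val i : X) x < e]).
  rewrite (_ : _ @^-1` _ = ~` [set x | mdist (val i : X) x < e]).
    exact: measurableC.
  by apply/seteqP; split=> x /=; [move=> ->|move/negP/negbTE].
exists _, (c \o enum_val), (enum_rank \o u); split.
  exact: fin_measurable_comp.
move=> x /=; rewrite enum_rankK /c; case: pickP => [i|ux].
  by rewrite ffunE metric_sym.
have [i /= iD xi] := XD x I.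
by have := ux (FSetSub iD); rewrite ffunE /= xi.
Qed.

(** A code [eta] computed from the itinerary of a fine label carries at most the entropy of that
    itinerary, and stays within [e] of the orbit at every time. *)
Lemma rate_distortion_le_ks_entropy (D : distortion_condition X) (e : R) :
  compact [set: X] -> 0 < e ->
  (forall d (Omega : measurableType d) (P : probability Omega R) n
     (xi : Omega -> X) (eta : Omega -> n.-tuple X), (0 < n)%N ->
     (forall (k : 'I_n) w, mdist (iter k T (xi w) : X) (tnth (eta w) k) < e) ->
     D d Omega P n xi eta) ->
  (rate_distortion mu D <= ks_entropy mu T)%E.
Proof.
move=> cX e0 De; have [N [c [a [ma ca]]]] := small_labels cX e0.
have [ul lu] := partition_ks_entropy_cvg mT iT ma.
set h := partition_ks_entropy _ _ _ in ul lu.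
apply: (@le_trans _ _ h%:E); last first.
  apply: ereal_sup_ubound; exists N, (fun i => a @^-1` [set i]); split => //.
  exact: label_finite_partition.
have ulE : (entropy (law mu (itinerary T a n)) / n%:R)%:E @[n --> \oo] --> h%:E.
  by apply: cvg_EFin => //; exact: nearW.
apply: (cvge_to_ge ulE); near=> n.
have n0 : (0 < n)%N by near: n; exact: nbhs_infty_gt.
have mit : fin_measurable (itinerary T a n) by exact: fin_measurable_itinerary.
(* The coupling lives on [X] itself: [xi] is the identity and [eta] replaces each point of the orbit
   by the center of its label. *)
pose xi : {RV mu >-> borel X} := HB.pack (idfun : borel X -> borel X)
  (isMeasurableFun.Build _ _ (borel X) (borel X) idfun
    (@measurable_id _ (borel X) setT)).
pose dec (u : {ffun 'I_n -> 'I_N}) : n.-tuple (borel X) := [tuple c (u k) | k < n].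
have meta : measurable_fun setT (dec \o itinerary T a n).
  by move=> _ A mA; rewrite setTI comp_preimage; exact: fin_measurable_preim.
pose eta : {RV mu >-> n.-tuple (borel X)} := HB.pack (dec \o itinerary T a n)
  (isMeasurableFun.Build _ _ (borel X) (n.-tuple (borel X)) _ meta).
apply: (@le_trans _ _ (mutual_information xi eta * (n%:R^-1)%:E)%E).
  apply: ereal_inf_lbound; exists n, _, (borel X), mu, xi, eta; split => //.
  apply: De => // k x.
  rewrite /= tnth_mktuple ffunE; exact: ca.
rewrite EFinM lee_wpmul2r ?lee_fin//.
apply: mutual_information_le => m m' a' b' ma' mb'.
rewrite lee_fin; apply: (le_trans (information_le_entropy _ _ _)).
- exact: fin_measurable_precomp.
- exact: fin_measurable_precomp.
exact: (entropy_law_comp mu (b' \o dec) mit).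
Unshelve. all: by end_near. Qed.

End Bounds.

(** Real thresholds [M] below [h] let finite and infinite values of [h] share the same two
    hypotheses. *)
Lemma lim_at_right0_squeeze (R : realType) (f : R -> \bar R) (h : \bar R) :
  (forall e, 0 < e -> (f e <= h)%E) ->
  (forall M : R, (M%:E < h)%E ->
     exists2 c, 0 < c & forall e, 0 < e <= c -> (M%:E <= f e)%E) ->
  lim (f e @[e --> 0^'+]) = h.
Proof.
move=> fh hf; apply/cvg_lim => //.
have fh0 : \forall e \near 0^'+, (f e <= h)%E.
  by near=> e; apply: fh; near: e; exact: nbhs_right_gt.
have hf0 (M : R) : (M%:E < h)%E -> \forall e \near 0^'+, (M%:E <= f e)%E.
  move=> /hf[c c0 cf]; near=> e; apply: cf; apply/andP; split.
    by near: e; exact: nbhs_right_gt.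
  by near: e; exact: nbhs_right_le.
case: h => [r| |] in fh hf fh0 hf0 *.
- apply/fine_cvgP; split.
    near=> e; rewrite fin_numElt; apply/andP; split.
      apply: (@lt_le_trans _ _ (r - 1)%:E); first exact: ltNyr.
      by near: e; apply: hf0; rewrite lte_fin gtrBl.
    apply: (@le_lt_trans _ _ r%:E); last exact: ltry.
    by near: e.
  apply/cvgrPdist_le => eps eps0; near=> e.
  have f1 : ((r - eps)%:E <= f e)%E.
    by near: e; apply: hf0; rewrite lte_fin gtrBl.
  have f2 : (f e <= r%:E)%E by near: e.
  move: f1 f2; rewrite /=; case: (f e) => [x| |]//=; rewrite !lee_fin => f1 f2.
  by rewrite ger0_norm ?subr_ge0// lerBlDr addrC -lerBlDr.
- by apply/cvgeyPge => M; apply: hf0; exact: ltry.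
- apply: cvg_near_cst; near=> e; apply/eqP; rewrite -leeNy_eq.
  by near: e.
Unshelve. all: by end_near. Qed.

(** * Equality of each rate-distortion entropy with the Kolmogorov-Sinai entropy *)

Section Main.
Context (R : realType) (X : pmetricType R) (T : borel X -> borel X)
  (mu : probability (borel X) R).
Hypotheses (cX : compact [set: X]) (mT : measurable_fun setT T)
  (iT : invariant_measure mu T).

(** Choose a partition of entropy [h > M] and spend [h - M] per symbol in the Fano estimate: as
    [n * h] is at most the entropy of the [n]-step itinerary, at least [n * M] is left. All that is
    asked of [D] is to make large distortions rare. *)
Lemma rate_distortion_ge (M : R) : (M%:E < ks_entropy mu T)%E ->
  exists c s : R, [/\ 0 < c, 0 < s & forall D : distortion_condition X,
  (forall d (Omega : measurableType d) (P : probability Omega R) n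
     (xi : Omega -> X) (eta : Omega -> n.-tuple X) (B : 'I_n -> set Omega),
     (0 < n)%N -> D d Omega P n xi eta -> (forall k, measurable (B k)) ->
     (forall k w, B k w ->
       c <= mdist (iter k T (xi w) : X) (tnth (eta w) k)) ->
     \sum_k fine (P (B k)) <= s * n%:R) ->
  (M%:E <= rate_distortion mu D)%E].
Proof.
move=> /ereal_sup_gt[_ [m [A [pA ->]]]].
have [a ma ->] := finite_partition_label pA.
have [_] := partition_ks_entropy_cvg mT iT ma.
set h := partition_ks_entropy _ _ _ => hu; rewrite lte_fin => Mh.
have [|c [s [c0 s0 cs]]] := entropy_le_mutual_information mT iT (dlt := h - M) ma.
  by rewrite subr_gt0.
exists c, s; split=> // D Ds.
apply: le_ereal_inf_tmp => _ [n [d [W [P [xi [eta [n0 lxi Dxe ->]]]]]]].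
have nR : 0 < n%:R :> R by rewrite ltr0n.
have := cs _ _ P n xi eta lxi (fun B mB Bc => Ds _ _ P n xi eta B n0 Dxe mB Bc).
move=> le_mi; rewrite lee_pdivlMr//; apply: le_trans le_mi.
rewrite -EFinM lee_fin.
have := hu n n0; rewrite ler_pdivlMr//; lra.
Qed.

Lemma h_Bowen_ks_entropy : h_Bowen mu T = ks_entropy mu T.
Proof.
apply: lim_at_right0_squeeze => [e e0|M /rate_distortion_ge[c [s [c0 s0 cs]]]].
  (* Scale [e / 2] leaves room for the strict inequality, since [expectation_le_cst] only gives a
     weak one. *)
  have e20 : 0 < e / 2 by rewrite divr_gt0.
  apply: (rate_distortion_le_ks_entropy mT iT cX e20).
  move=> d Omega P n xi eta n0 de; rewrite /distortion_Bowen.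
  apply: (@le_lt_trans _ _ (e / 2)%:E); last first.
    by rewrite lte_fin ltr_pdivrMr// ltr_pMr// ltr1n.
  apply: expectation_le_cst => w; apply/andP; split.
    exact: bigmax_ge_id.
  by apply: bigmax_le => [|k _]; rewrite ltW.
(* The maximum is at least [c / n] times the number of events [B k] that occur, so their
   probabilities sum to less than [e * n / c], which is at most [s * n]. *)
exists (s * c) => [|e /andP[e0 esc]]; first exact: mulr_gt0.
apply: cs => d Omega P n xi eta B n0 DB mB Bc.
have nR : 0 < n%:R :> R by rewrite ltr0n.
have cn0 : 0 <= c / n%:R by rewrite divr_ge0 ?ltW.
have : c / n%:R * \sum_k fine (P (B k)) < e.
  apply: (sum_prob_lt cn0 mB DB) => w; rewrite mulrAC ler_pdivrMr//.
  rewrite mulr_sumr mulr_natr.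
  set F := (X in _ <= X *+ _).
  apply: (@le_trans _ _ (\sum_(k < n) F)); last by rewrite sumr_const card_ord.
  apply: ler_sum => k _; rewrite indicE; case: (boolP (w \in B k)) => [|_].
    rewrite inE mulr1 => /Bc cw; apply: (le_trans cw).
    exact: (le_bigmax 0 (fun k : 'I_n =>
      mdist (iter k T (xi w) : X) (tnth (eta w) k)) k).
  by rewrite mulr0; exact: bigmax_ge_id.
rewrite mulrAC ltr_pdivrMr// => lt; rewrite -(ler_pM2l c0) (le_trans (ltW lt))//.
by rewrite mulrA [c * s]mulrC ler_wpM2r.
Qed.

Lemma R_Linfty_s_le (e s : R) : 0 < e -> 0 < s ->
  (R_Linfty_s mu T e s <= ks_entropy mu T)%E.
Proof.
move=> e0 s0; apply: (rate_distortion_le_ks_entropy mT iT cX e0).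
move=> d Omega P n xi eta n0 de; rewrite /distortion_Linfty.
apply: (@le_lt_trans _ _ 0%:E); last by rewrite lte_fin mulr_gt0// ltr0n.
apply: expectation_le_cst => w; rewrite ler0n lern0/=.
apply/eqP/eq_card0 => k; rewrite !inE; apply/negbTE.
by rewrite -ltNge.
Qed.

(** Raising [s] weakens the distortion condition, so the infimum is nonincreasing in [s]. This gives
    the inner [lim] of [h_Linfty] its meaning. *)
Lemma R_Linfty_s_cvg (e : R) : cvg (R_Linfty_s mu T e s @[s --> 0^'+]).
Proof.
apply: nonincreasing_at_right_is_cvge; near=> x => s1 s2 _ _ s12.
apply: le_ereal_inf => _ [n [d [W [P [xi [eta [n0 lxi De ->]]]]]]].
exists n, d, W, P, xi, eta; split => //.
by apply: (lt_le_trans De); rewrite lee_fin ler_wpM2r.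
Unshelve. all: by end_near. Qed.

Lemma h_Linfty_ks_entropy : h_Linfty mu T = ks_entropy mu T.
Proof.
apply: lim_at_right0_squeeze => [e e0|M /rate_distortion_ge[c [s [c0 s0 cs]]]].
  apply: lime_le; first exact: R_Linfty_s_cvg.
  near=> s; apply: R_Linfty_s_le => //; near: s; exact: nbhs_right_gt.
(* For [e <= c] the distortion counts every [k] for which [B k] occurs, so the expected number of
   these is below [s' * n]. *)
exists c => // e /andP[e0 ec].
apply: lime_ge; first exact: R_Linfty_s_cvg.
near=> s'; apply: cs => d Omega P n xi eta B n0 DB mB Bc.
have ss : s' <= s by near: s'; exact: nbhs_right_le.
apply: (@le_trans _ _ (s' * n%:R)); last by rewrite ler_wpM2r.
rewrite -[leLHS]mul1r ltW//; apply: (sum_prob_lt _ mB DB) => // w.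
rewrite mul1r.
rewrite -sum1_card natr_sum [leRHS]big_mkcond/=; apply: ler_sum => k _.
rewrite indicE; case: (boolP (w \in B k)) => [|_]; last by case: ifP.
by rewrite inE => /Bc cw; rewrite inE (le_trans ec cw).
Unshelve. all: by end_near. Qed.

Lemma h_Lp_ks_entropy (p : R) : 1 <= p -> h_Lp mu T p = ks_entropy mu T.
Proof.
move=> p1; have p0 : 0 < p by exact: lt_le_trans p1.
apply: lim_at_right0_squeeze => [e e0|M /rate_distortion_ge[c [s [c0 s0 cs]]]].
  have e20 : 0 < e / 2 by rewrite divr_gt0.
  apply: (rate_distortion_le_ks_entropy mT iT cX e20).
  move=> d Omega P n xi eta n0 de; rewrite /distortion_Lp.
  have nR : 0 < n%:R :> R by rewrite ltr0n.
  apply: (@le_lt_trans _ _ ((e / 2) `^ p)%:E); last first.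
    rewrite lte_fin gt0_ltr_powR// ?nnegrE ?ltW//.
    by rewrite ltr_pdivrMr// ltr_pMr// ltr1n.
  apply: expectation_le_cst => w; apply/andP; split.
    by rewrite mulr_ge0 ?invr_ge0 ?ler0n// sumr_ge0// => k _; exact: powR_ge0.
  rewrite ler_pdivrMl// mulr_natl.
  apply: (@le_trans _ _ (\sum_(k < n) (e / 2) `^ p)); last first.
    by rewrite sumr_const card_ord.
  apply: ler_sum => k _; have [p0' e20'] := (ltW p0, ltW e20).
  by apply: ge0_ler_powR; rewrite ?nnegrE ?mdist_ge0 ?(ltW (de _ _)).
(* Markov's inequality for [p]-th powers asks for [e ^ p <= s * c ^ p]; with [e <= 1 <= p] it
   suffices that [e <= s * c ^ p]. *)
exists (Num.min 1 (s * c `^ p)) => [|e /andP[e0]].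
  by rewrite lt_min ltr01 mulr_gt0// powR_gt0.
rewrite le_min => /andP[e1 esc].
apply: cs => d Omega P n xi eta B n0 DB mB Bc.
have nR : 0 < n%:R :> R by rewrite ltr0n.
have cn0 : 0 <= c `^ p / n%:R by rewrite divr_ge0 ?powR_ge0 ?ltW.
have : c `^ p / n%:R * \sum_k fine (P (B k)) < e `^ p.
  apply: (sum_prob_lt cn0 mB DB) => w; rewrite [_ / _]mulrC -mulrA.
  rewrite ler_wpM2l ?invr_ge0 ?ler0n// mulr_sumr.
  apply: ler_sum => k _; rewrite indicE; case: (boolP (w \in B k)) => [|_].
    rewrite inE mulr1 => /Bc cw.
    have [p0' c0'] := (ltW p0, ltW c0).
    by apply: ge0_ler_powR; rewrite ?nnegrE ?mdist_ge0.
  by rewrite mulr0 powR_ge0.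
have cp0 : 0 < c `^ p by rewrite powR_gt0.
rewrite mulrAC ltr_pdivrMr// => lt; rewrite -(ler_pM2l cp0) (le_trans (ltW lt))//.
rewrite mulrA [_ * s]mulrC ler_wpM2r//; apply: le_trans esc.
by apply: ge1r_powR; rewrite ?e0.
Qed.

End Main.

Theorem theorem2 (R : realType) (X : pmetricType R) (T : X -> X)
    (cX : compact [set: X]) (hT : homeomorphism T) :
  (forall (mu : probability (borel X) R) (p : R),
     ergodic_measure mu T -> 1 <= p ->
     [/\ h_Lp mu T p = h_Linfty mu T,
         h_Linfty mu T = h_Bowen mu T
       & h_Bowen mu T = ks_entropy mu T])
  /\
  (forall g : nat -> nat, mistake_function R g -> almost_product_property T g ->
   forall (mu : probability (borel X) R) (p : R),
     invariant_measure mu T -> 1 <= p ->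
     [/\ h_Lp mu T p = h_Linfty mu T,
         h_Linfty mu T = h_Bowen mu T
       & h_Bowen mu T = ks_entropy mu T]).
Proof.
have mT : measurable_fun setT (T : borel X -> borel X).
  by apply: continuous_borel_measurable; case: hT.
have main (mu : probability (borel X) R) p : invariant_measure mu T -> 1 <= p ->
    [/\ h_Lp mu T p = h_Linfty mu T, h_Linfty mu T = h_Bowen mu T
     & h_Bowen mu T = ks_entropy mu T].
  move=> iT p1; have hB := h_Bowen_ks_entropy cX mT iT.
  have hI := h_Linfty_ks_entropy cX mT iT.
  have hp := h_Lp_ks_entropy cX mT iT p1.
  by split; [rewrite hp -hI|rewrite hI -hB|exact: hB].
by split=> [mu p [iT _]|g _ _ mu p]; exact: main.
Qed.
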